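(* Let $T$ be a linear relation from a Hilbert space $\mathfrak H$ to a Hilbert space $\mathfrak K$, let $\widetilde R$ be the orthogonal projection from $\mathfrak H\times\mathfrak K$ onto the closure $\overline T$, and write $\widetilde R=\begin{pmatrix}\widetilde R_{11}&\widetilde R_{12}\\ \widetilde R_{21}&\widetilde R_{22}\end{pmatrix}$ with respect to the Cartesian product $\mathfrak H\times\mathfrak K$. Then $T$ is regular if and only if $$\ker(I-\widetilde R_{22})=\{0\}.$$
   Context: Hilbert spaces are complex. A linear relation $T$ from $\mathfrak H$ to $\mathfrak K$ is a (not necessarily closed) linear subspace of the Hilbert space $\mathfrak H\times\mathfrak K$; $\overline T$ is its closure. $T$ is regular if $\overline T$ is (the graph of) an operator, i.e. $\operatorname{mul}\overline T=\{f'\in\mathfrak K:\{0,f'\}\in\overline T\}=\{0\}$. *)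

(* Defs.v *)
From HB Require Import structures.
From mathcomp Require Import all_boot all_order all_algebra.
From mathcomp Require Import complex.
From mathcomp Require Import all_classical all_reals all_analysis.

Set Implicit Arguments.
Unset Strict Implicit.
Unset Printing Implicit Defensive.

Import Order.TTheory GRing.Theory Num.Theory.
Import numFieldNormedType.Exports.

Local Open Scope classical_set_scope.
Local Open Scope ring_scope.

(* Complex Hilbert spaces. A form of type {dot H for Num.conj} is linear in
   its first argument and conjugate-linear in its second one. *)
HB.mixin Record CompleteNormedModule_isHilbert (R : realType) H
    of CompleteNormedModule R[i] H := {
  inner : {dot H for Num.conj} ;
  innerxx : forall x : H, inner x x = `|x| ^+ 2
}.

#[short(type="hilbertType")]
HB.structure Definition Hilbert (R : realType) :=
  { H of CompleteNormedModule R[i] H & CompleteNormedModule_isHilbert R H }.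

Arguments inner {R s}.

Section ProductInner.
Context {R : realType} (H K : hilbertType R).

(* The norm that MathComp-Analysis puts on H * K is the sup norm, so H * K with
   this form is not a canonical hilbertType; the Hilbert norm is equivalent to
   the sup norm, hence closures in H * K are unaffected. *)
Definition prod_inner (u v : H * K) : R[i] :=
  inner u.1 v.1 + inner u.2 v.2.

Let prod_inner_bilinear : bilinear_for *%R (Num.conj \; *%R) prod_inner.
Proof.
split=> u a x y /=; rewrite /prod_inner/=.
- by rewrite !linearPl/= mulrDr addrACA.
- by rewrite !linearPr/= mulrDr addrACA.
Qed.

HB.instance Definition _ := bilinear_isBilinear.Build R[i] (H * K)%type
  (H * K)%type R[i] *%R (Num.conj \; *%R) prod_inner prod_inner_bilinear.

Let prod_inner_hermitian u v :
  prod_inner u v = (-1) ^+ false * Num.conj (prod_inner v u).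
Proof.
rewrite /prod_inner (hermC inner u.1) (hermC inner u.2).
by rewrite !expr0 !mul1r rmorphD.
Qed.

HB.instance Definition _ := isHermitianSesquilinear.Build R[i] (H * K)%type
  false Num.conj prod_inner prod_inner_hermitian.

Let prod_inner_gt0 u : u != 0 -> 0 < prod_inner u u.
Proof.
case: u => h k; rewrite /prod_inner/= !innerxx => hk.
rewrite lt_neqAle addr_ge0 ?exprn_ge0// andbT eq_sym.
rewrite paddr_eq0 ?exprn_ge0// !expf_eq0/= !normr_eq0.
by apply: contra hk => /andP[/eqP-> /eqP->].
Qed.

HB.instance Definition _ := isDotProduct.Build R[i] (H * K)%type
  prod_inner prod_inner_gt0.

End ProductInner.

(* P is the orthogonal projection onto M: for every x, P x lies in M and x - P x
   is orthogonal to M. *)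
Definition orthogonal_projection {R : realType} {V : lmodType R[i]}
    (dot : {dot V for Num.conj}) (M : set V) (P : V -> V) : Prop :=
  forall x, M (P x) /\ (forall y, M y -> dot (x - P x) y = 0).

Definition op_ker {U V : zmodType} (f : U -> V) : set U := f @^-1` [set 0].

Section LinearRelations.
Context {R : realType} {H K : hilbertType R}.
Implicit Types T : set (H * K).

Definition linear_relation T : Prop := submod_closed [in T].

Definition mul_part T : set K := [set k | T (0, k)].

Definition regular_relation T : Prop := mul_part (closure T) = [set 0].

End LinearRelations.

Section Blocks.
Context {R : realType} {H K : hilbertType R}.
Implicit Type A : H * K -> H * K.

Definition block11 A (h : H) : H := (A (h, 0)).1.
Definition block12 A (k : K) : H := (A (0, k)).1.
Definition block21 A (h : H) : K := (A (h, 0)).2.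
Definition block22 A (k : K) : K := (A (0, k)).2.

Lemma blockE (A : {linear (H * K)%type -> (H * K)%type}) h k :
  A (h, k) = (block11 A h + block12 A k, block21 A h + block22 A k).
Proof.
have -> : (h, k) = (h, 0) + (0, k) :> (H * K)%type.
  by congr pair; rewrite ?addr0 ?add0r.
by rewrite linearD.
Qed.

End Blocks.

(* Main.v *)
(** For any set [M] with an orthogonal projection [P], the multivalued part of
    [M] equals [ker (I - P_22)]: if [u = (0, k)] lies in [M] then [u - P u] is
    orthogonal to both [u] and [P u], so [P u = u]; conversely, if
    [P (0, k) = (h, k)] then [u - P u = (-h, 0)] is orthogonal to [(h, k)],
    which forces [h = 0] and hence [(0, k) = P (0, k)] in [M]. *)

Require Import Defs.
From HB Require Import structures.
From mathcomp Require Import all_boot all_order all_algebra.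
From mathcomp Require Import complex.
From mathcomp Require Import all_classical all_reals all_analysis.
Import Order.TTheory GRing.Theory Num.Theory.
Import numFieldNormedType.Exports.
Local Open Scope classical_set_scope.
Local Open Scope ring_scope.

Lemma orthogonal_projection_id {R : realType} {V : lmodType R[i]}
    {dot : {dot V for Num.conj}} {M : set V} {P : V -> V} {x : V} :
  orthogonal_projection dot M P -> M x -> P x = x.
Proof.
move=> hP Mx; have [MPx orth] := hP x.
apply/eqP; rewrite eq_sym -subr_eq0 -(dnorm_eq0 dot).
(* Expanding the second argument leaves pairings with [x] and [P x], both in [M]; as [M] is a bare
   set, [x - P x] itself may lie outside it. *)
by rewrite linearBr/= !orth// subrr.
Qed.

Lemma mul_part_block22 {R : realType} {H K : hilbertType R}
    {M : set (H * K)} {P : H * K -> H * K} :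
  orthogonal_projection (@prod_inner R H K) M P ->
  mul_part M = op_ker (idfun \- block22 P).
Proof.
move=> hP; rewrite /mul_part /op_ker /block22; apply/seteqP; split=> k /=.
  by move=> Mk; rewrite (orthogonal_projection_id hP Mk) subrr.
move=> /eqP; rewrite subr_eq0 => /eqP.
have := hP (0, k); case: (P (0, k)) => h k' [Mhk orth] /= kE.
rewrite -{k'}kE in Mhk orth.
(* The residual is tested against the projected point itself: the [K] part cancels and minus the
   squared norm of [h] remains. *)
have : inner (0 - h) h + inner (k - k) k = 0 by exact: orth Mhk.
rewrite subrr linear0l addr0 sub0r linearNl/= innerxx => /eqP.
by rewrite oppr_eq0 expf_eq0/= normr_eq0 => /eqP h0; rewrite h0 in Mhk.
Qed.

Theorem proposition7p1 (R : realType) (H K : hilbertType R)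
    (T : set (H * K)) (hT : linear_relation T)
    (P : {linear (H * K)%type -> (H * K)%type})
    (hP : orthogonal_projection (@prod_inner R H K) (closure T) P) :
  regular_relation T <-> op_ker (idfun \- block22 P) = [set 0].
(* With [M := closure T] the two sets coincide, so both sides become the same equation. *)
Proof. by rewrite /regular_relation (mul_part_block22 hP). Qed.
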